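(* The following hold. 1. The set $\mathcal{N}$ of (absolutely) normal numbers is not super-dense. 2. The set of non-normal numbers $\mathcal{N}^c = \mathbb{R}\setminus\mathcal{N}$ is super-dense, and for each integer base $b \ge 2$ the set $\mathcal{Z}_b$ is super-dense. 3. For each integer base $b \ge 2$ the set $\mathcal{Z}_b$ has Hausdorff dimension $0$, whereas $\mathcal{N}^c$ has full Hausdorff dimension $1$.
   Context: Nowhere constant: for a non-empty open interval $I \subset \mathbb{R}$, a function $\varphi: I \to \mathbb{R}$ is nowhere constant if for every $t_0 \in I$ and every $\varepsilon>0$ there is $t \in I \cap (t_0-\varepsilon,t_0+\varepsilon)$ with $\varphi(t) \ne \varphi(t_0)$. Super-dense: a set $A \subset \mathbb{R}$ is super-dense if for every non-empty open interval $I$ and every nowhere constant continuous function $\varphi : I \to \mathbb{R}$ one has $\varphi(I \cap A) \cap A \neq \emptyset$. Digits: for an integer base $b\ge 2$ and $x \in [0,1)$, write $x = 0.x_1x_2x_3\ldots$ for its $b$-ary expansion, $x_i\in\{0,\dots,b-1\}$, made unique by using a finite expansion (only finitely many nonzero digits) whenever possible. For $d \in \{0,\dots,b-1\}$ and $M\ge 1$ let $\Lambda_{b,d,M}(x) = \frac1M |\{1 \le j \le M : x_j = d\}|$; for general $x \in \mathbb{R}$ set $\Lambda_{b,d,M}(x) := \Lambda_{b,d,M}(|x| \bmod 1)$, i.e. the fractional digits of $|x|$ are used. Normality: $x$ is $b$-normal if every finite word $w$ over $\{0,\dots,b-1\}$ appears with asymptotic frequency $b^{-|w|}$ in the $b$-ary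 expansion of $x$, where $|w|$ is the length of $w$; $x$ is (absolutely) normal if it is $b$-normal for all integers $b\ge2$. $\mathcal{N}$ is the set of all normal real numbers. $\mathcal{Z}_b := \{x \in \mathbb{R} : \limsup_{M\to\infty} \Lambda_{b,0,M}(x) = 1\}$. *)

(* Defs.v *)
From HB Require Import structures.
From mathcomp Require Import all_boot all_order all_algebra.
From mathcomp Require Import all_classical all_reals all_analysis.

Set Implicit Arguments.
Unset Strict Implicit.
Unset Printing Implicit Defensive.
Import Order.TTheory GRing.Theory Num.Theory.
Import numFieldNormedType.Exports.

Local Open Scope classical_set_scope.
Local Open Scope ring_scope.

(* A function I -> R is represented by a total function phi : R -> R; none of
   the conditions below depends on its values outside I. *)
Definition nowhere_constant (R : realType) (I : set R) (phi : R -> R) : Prop :=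
  forall t0, I t0 -> forall eps : R, 0 < eps ->
    exists t, [/\ I t, `|t - t0| < eps & phi t <> phi t0].

Definition super_dense (R : realType) (A : set R) : Prop :=
  forall (I : set R) (phi : R -> R),
    open I -> is_interval I -> I !=set0 ->
    {within I, continuous phi} -> nowhere_constant I phi ->
    (phi @` (I `&` A)) `&` A !=set0.

(* Digit sequences are indexed from 0: the digit x_(i+1) in the expansion
   x = 0.x_1x_2x_3... is [a i]. *)
Definition bary_expansion (R : realType) (b : nat) (x : R) (a : nat -> nat)
    : Prop :=
  (forall i, (a i < b)%N) /\
  series (fun i => (a i)%:R / b%:R ^+ i.+1 : R) @ \oo --> x.

Definition finite_expansion (a : nat -> nat) : Prop :=
  exists n, forall i, (n <= i)%N -> a i = 0%N.

Definition proper_expansion (R : realType) (b : nat) (x : R) (a : nat -> nat)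
    : Prop :=
  bary_expansion b x a /\
  ((exists a', bary_expansion b x a' /\ finite_expansion a') ->
   finite_expansion a).

Definition frac_abs (R : realType) (x : R) : R :=
  `|x| - (Num.floor `|x|)%:~R.

(* For 2 <= b there is exactly one proper expansion of a number in [0, 1), so
   the choice operator has no freedom. *)
Definition digit (R : realType) (b : nat) (x : R) : nat -> nat :=
  xget (fun=> 0%N) [set a | proper_expansion b (frac_abs x) a].

Definition digit_freq (R : realType) (b d M : nat) (x : R) : R :=
  #|[pred j : 'I_M | digit b x j == d]|%:R / M%:R.

(* The occurrences of w are counted by their starting positions. *)
Definition word_freq (R : realType) (b : nat) (w : seq nat) (M : nat) (x : R)
    : R :=
  #|[pred j : 'I_M | mkseq (fun k => digit b x (j + k)%N) (size w) == w]|%:R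
  / M%:R.

Definition base_normal (R : realType) (b : nat) (x : R) : Prop :=
  forall w : seq nat, all (fun d => (d < b)%N) w ->
    (fun M => word_freq b w M x) @ \oo --> (b%:R ^- size w : R).

Definition normal_numbers (R : realType) : set R :=
  [set x | forall b, (2 <= b)%N -> base_normal b x].
Arguments normal_numbers R : clear implicits.

Definition Zset (R : realType) (b : nat) : set R :=
  [set x | limn_esup (fun M => (digit_freq b 0 M x)%:E) = 1%E].
Arguments Zset R b : clear implicits.

Definition diam (R : realType) (U : set R) : \bar R :=
  ereal_sup (0%E |` [set `|p.1 - p.2|%:E | p in U `*` U]).

(* The empty set gets weight 0 also for s = 0, so that covers by finitely many
   sets can be padded with empty sets; nonempty U has weight 1 when s = 0. *)
Definition diam_pow (R : realType) (s : R) (U : set R) : \bar R :=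
  if U == set0 then 0%E else poweR (diam U) s.

Definition hausdorff_content (R : realType) (s delta : R) (A : set R)
    : \bar R :=
  ereal_inf [set (\sum_(0 <= i <oo) diam_pow s (U i))%E |
    U in [set U : nat -> set R | A `<=` \bigcup_i U i /\
                                 forall i, (diam (U i) <= delta%:E)%E]].

Definition hausdorff_measure (R : realType) (s : R) (A : set R) : \bar R :=
  ereal_sup [set hausdorff_content s delta A | delta in [set d : R | 0 < d]].

Definition hausdorff_dim (R : realType) (A : set R) : \bar R :=
  ereal_inf [set s%:E | s in [set s : R | 0 <= s /\
                                         hausdorff_measure s A = 0%E]].

(* Main.v *)
Require Import Defs.
From mathcomp Require Import all_boot all_order all_algebra.
From mathcomp Require Import all_classical all_reals all_analysis.
From mathcomp Require Import zify ring lra.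
Import Order.TTheory GRing.Theory Num.Theory.
Import numFieldNormedType.Exports.

Set Implicit Arguments.
Unset Strict Implicit.
Unset Printing Implicit Defensive.

Local Open Scope classical_set_scope.
Local Open Scope ring_scope.

(** Everything rests on one description of digits ([digitE]): the digit of
    index i of x in base b is the integer part of b^(i+1) |x| reduced modulo b.

    Normal numbers are not super-dense because of an explicit zigzag function f
    on ]0, 1[, continuous and nowhere constant, that reads x in base 5 and
    writes f x in base 3. On the five fifths of a cell, f runs through the
    thirds 0, 1, 1, 1, 2 of the image interval, the middle passage being
    traversed backwards, so that consecutive passages share an endpoint and f is
    continuous. Reversing a cell exchanges the outer thirds and fixes the middle
    one, so the digit 1 of f x occurs exactly where x has one of the digits
    1, 2, 3. If x is normal, this happens with frequency 3/5 instead of 1/3, and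
    f x is not normal ([zigzag_not_normal]).

    The set Z_b is super-dense because it contains a dense countable
    intersection of open sets: numbers having, for each m, a prefix of some
    length M followed by mM zeros. A nowhere constant continuous function pulls
    dense open sets back to dense open sets, and Baire's theorem applied to the
    residual set and its preimage together gives the required point
    ([comeager_super_dense]). No element of Z_b is normal, whence the same
    property for the complement of the normal numbers.

    For every s > 0 the set Z_b has s-dimensional measure zero by box counting
    ([hausdorff_null_cells]): at infinitely many levels M a point of Z_b lies in
    a b-adic cell whose address has a tiny proportion of nonzero digits, and a
    generating function shows that there are few such cells ([Zset_null]).

    The complement of the normal numbers has dimension at most 1 by counting all
    dyadic cells, and at least 1 because it contains, for each c, the numbers
    whose expansion in base c + 1 avoids the digit c. Rereading such expansions
    in base c produces all of [0, 1) and is Hoelder continuous with an exponent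
    tending to 1 as c grows ([missing_digit_embedding]); hence covers with small
    weight would contradict the Lebesgue measure of [0, 1)
    ([nonnormal_not_null]). *)

(** * Digits as truncations *)

Fixpoint digits_value (b : nat) (a : nat -> nat) (n : nat) : nat :=
  if n is n'.+1 then (b * digits_value b a n' + a n')%N else 0%N.

(** Being a sum of the series with digits a amounts to lying in all the nested
    intervals cut out by the prefixes of a. The intervals are closed: the
    right-hand bound is reached by expansions that end in digits b - 1. *)
Definition digit_enclosure (R : realType) (b : nat) (a : nat -> nat) (x : R)
    : Prop :=
  forall n, (digits_value b a n)%:R <= b%:R ^+ n * x
            <= (digits_value b a n).+1%:R.

Section Expansions.
Variables (R : realType) (b : nat).
Hypothesis b_ge2 : (2 <= b)%N.
Implicit Types (x y : R) (a : nat -> nat).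

Let b_gt0 : 0 < b%:R :> R. Proof. by rewrite ltr0n; lia. Qed.
Let b_gt1 : 1 < b%:R :> R. Proof. by rewrite ltr1n. Qed.
Let bX_gt0 n : 0 < b%:R ^+ n :> R. Proof. by rewrite exprn_gt0. Qed.
Let b_neq0 : b%:R != 0 :> R. Proof. by rewrite gt_eqF. Qed.

Lemma series_digits a n :
  series (fun i => (a i)%:R / b%:R ^+ i.+1 : R) n =
  (digits_value b a n)%:R / b%:R ^+ n.
Proof.
elim: n => [|n IHn]; first by rewrite /series /= big_geq // mul0r.
rewrite seriesSr IHn /= natrD natrM exprS.
field; rewrite b_neq0 expf_neq0 //.
Qed.

(** Appending digits multiplies the value by a power of b and adds less than
    that power. *)
Lemma digits_value_extend a n m : (forall i, (a i < b)%N) -> (n <= m)%N ->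
  (digits_value b a n * b ^ (m - n) <= digits_value b a m)%N /\
  (digits_value b a m < (digits_value b a n).+1 * b ^ (m - n))%N.
Proof.
move=> ab; elim: m => [|m IHm] nm.
  by have -> : n = 0%N by lia.
have [nm'|] := leqP n m; last first.
  move=> ?; have -> : n = m.+1 by lia.
  by rewrite subnn !muln1 ltnSn leqnn.
have [IH1 IH2] := IHm nm'; rewrite subSn// expnS /=.
have := ab m; nia.
Qed.

Lemma bary_expansion_enclosure x a :
  bary_expansion b x a -> digit_enclosure b a x.
Proof.
move=> [ab ax] n.
have B m : (n <= m)%N ->
    (digits_value b a n)%:R / (b%:R : R) ^+ n <=
      (digits_value b a m)%:R / (b%:R : R) ^+ m <=
      (digits_value b a n).+1%:R / (b%:R : R) ^+ n.
  move=> nm; have [h1 h2] := digits_value_extend ab nm.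
  have E k : k%:R / b%:R ^+ n = (k * b ^ (m - n))%:R / b%:R ^+ m :> R.
    rewrite -[in b%:R ^+ m](subnK nm) exprD natrM natrX.
    by field; rewrite !expf_neq0.
  by rewrite !E !ler_pM2r ?invr_gt0// !ler_nat h1 ltnW.
apply/andP; split; rewrite [_ * x]mulrC.
  rewrite -ler_pdivrMr//; apply: (cvgr_to_ge ax).
  by exists n => // m /= nm; rewrite series_digits; have /andP[] := B m nm.
rewrite -ler_pdivlMr//; apply: (cvgr_to_le ax).
by exists n => // m /= nm; rewrite series_digits; have /andP[] := B m nm.
Qed.

Lemma enclosure_bary_expansion x a : (forall i, (a i < b)%N) ->
  digit_enclosure b a x -> bary_expansion b x a.
Proof.
move=> ab ax; split=> //.
have h : (fun n => x - (b%:R^-1) ^+ n) @ \oo --> x.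
  rewrite -[X in _ --> X]subr0; apply: cvgB; first exact: cvg_cst.
  by apply: cvg_expr; rewrite ger0_norm ?invr_ge0 ?ltW// invf_lt1.
apply: (squeeze_cvgr _ h (cvg_cst x)); apply: nearW => n.
have /andP[h1 h2] := ax n.
rewrite series_digits ler_pdivrMr// [x * _]mulrC h1 andbT.
rewrite lerBlDr exprVn -[X in _ + X]mul1r -mulrDl ler_pdivlMr// mulrC.
by rewrite natr1.
Qed.

Lemma truncn_div_expr x n : 0 <= x ->
  (Num.truncn (b%:R ^+ n.+1 * x) %/ b)%N = Num.truncn (b%:R ^+ n * x).
Proof.
move=> x0; set t := Num.truncn (b%:R ^+ n * x).
have /andP[h1 h2] : t%:R <= b%:R ^+ n * x < t.+1%:R.
  by apply: truncn_itv; rewrite mulr_ge0// ltW.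
have y0 : 0 <= b%:R ^+ n.+1 * x by rewrite mulr_ge0// ltW.
have h3 : (t * b <= Num.truncn (b%:R ^+ n.+1 * x))%N.
  by rewrite truncn_ge_nat// natrM mulrC exprS -mulrA ler_pM2l.
have h4 : (Num.truncn (b%:R ^+ n.+1 * x) < t.+1 * b)%N.
  by rewrite truncn_lt_nat// natrM mulrC [X in _ < X]mulrC exprS mulrC -mulrA ltr_pM2l.
apply/eqP; rewrite eqn_leq leq_divRL; last by lia.
by rewrite h3 andbT -ltnS ltn_divLR//; lia.
Qed.

Lemma truncn_expr_eq x n : 0 <= x -> Num.truncn (b%:R ^+ n.+1 * x) =
  (b * Num.truncn (b%:R ^+ n * x) +
   Num.truncn (b%:R ^+ n.+1 * x) %% b)%N.
Proof.
by move=> x0; rewrite -(truncn_div_expr n)// [X in (X + _)%N]mulnC -divn_eq.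
Qed.

Definition floor_digit x (i : nat) : nat :=
  (Num.truncn (b%:R ^+ i.+1 * x) %% b)%N.

Lemma floor_digit_lt x i : (floor_digit x i < b)%N.
Proof. by rewrite ltn_pmod//; lia. Qed.

Lemma digits_value_floor x n : 0 <= x < 1 ->
  digits_value b (floor_digit x) n = Num.truncn (b%:R ^+ n * x).
Proof.
move=> /andP[x0 x1]; elim: n => [|n IHn] /=.
  rewrite expr0 mul1r; apply/esym/eqP.
  by rewrite truncn_eq// x0.
by rewrite IHn [RHS]truncn_expr_eq.
Qed.

Lemma floor_digit_bary x : 0 <= x < 1 -> bary_expansion b x (floor_digit x).
Proof.
move=> x01; apply: enclosure_bary_expansion; first exact: floor_digit_lt.
move=> n; rewrite digits_value_floor//.
have /truncn_itv /andP[h1 h2] : 0 <= b%:R ^+ n * x.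
  by rewrite mulr_ge0 ?(ltW (bX_gt0 _))//; case/andP: x01.
by rewrite h1 ltW.
Qed.

(** If some expansion of x is finite, then b^m x is an integer for large m and
    the truncated digits vanish as well. *)
Lemma floor_digit_proper x : 0 <= x < 1 ->
  proper_expansion b x (floor_digit x).
Proof.
move=> x01; split; first exact: floor_digit_bary.
move=> [a [ax [n an]]]; exists n => i ni.
have bv m : (n <= m)%N -> b%:R ^+ m * x = (digits_value b a m)%:R.
  have [h1 h2] := ax; move=> nm.
  have E k : (n <= k)%N -> (digits_value b a k)%:R / b%:R ^+ k =
             (digits_value b a n)%:R / b%:R ^+ n :> R.
    elim: k => [|k IHk] nk; first by have -> : n = 0%N by lia.
    have [nk'|?] := leqP n k; last by have -> : n = k.+1 by lia.
    rewrite -IHk//= an// addn0 natrM exprS.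
    by field; rewrite b_neq0 expf_neq0.
  have xE : x = (digits_value b a n)%:R / b%:R ^+ n.
    apply: (cvg_unique _ h2) => //.
    apply: cvg_near_cst; exists n => // k /= nk.
    by rewrite series_digits E.
  by rewrite xE -(E m nm) mulrCA divff ?mulr1// expf_neq0.
rewrite /floor_digit bv; last by lia.
by rewrite natrK /= an// addn0 mulnC modnMl.
Qed.

(** Two expansions of the same number can only differ where the rescaled tail
    of one of them equals 1; from there on all its digits are b - 1, while the
    number has a finite expansion, so such an expansion is not proper. *)
Lemma proper_expansion_unique x a : 0 <= x < 1 -> proper_expansion b x a ->
  a = floor_digit x.
Proof.
move=> x01 [ax afin].
have bnd := bary_expansion_enclosure ax; have [ab _] := ax.
have x0 : 0 <= x by case/andP: x01.
have lt n : b%:R ^+ n * x < (digits_value b a n).+1%:R.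
  have /andP[_ le1] := bnd n; rewrite lt_neqAle le1 andbT; apply/eqP => e.
  (* Equality propagates: the tail of every later index is 1 as well. *)
  have tail m : (n <= m)%N -> b%:R ^+ m * x = (digits_value b a m).+1%:R /\
                              ((n < m)%N -> a m.-1 = b.-1).
    elim: m => [|m IHm] nm; first by move: nm; rewrite leqn0 => /eqP <-; rewrite ltnn.
    have [nm'|?] := leqP n m; last first.
      by (have <- : n = m.+1 by lia); rewrite ltnn.
    have [IH _] := IHm nm'; have /andP[_ h] := bnd m.+1.
    have am := ab m; move: h.
    rewrite /= exprS -mulrA IH -natrM ler_nat => h.
    have amE : a m = b.-1 by nia.
    by split=> //; congr (_%:R); rewrite amE; nia.
  have [k ak] : finite_expansion a.
    apply: afin; exists (floor_digit x).
    split; first exact: floor_digit_bary.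
    exists n => i ni; rewrite /floor_digit (tail i.+1 _).1; last by lia.
    have [_ aiE] := tail i.+1 (leqW ni).
    rewrite natrK /= aiE ?ltnS//.
    have -> : (b * digits_value b a i + b.-1).+1 =
              ((digits_value b a i).+1 * b)%N by nia.
    by rewrite modnMl.
  have [_ aE] := tail (maxn n k).+1 (leqW (leq_maxl n k)).
  have := ak (maxn n k) (leq_maxr n k); rewrite -/((maxn n k).+1.-1).
  by rewrite aE ?ltnS ?leq_maxl//; lia.
have tE n : Num.truncn (b%:R ^+ n * x) = digits_value b a n.
  by apply/truncn_def; rewrite lt andbT; have /andP[] := bnd n.
apply/funext => i; rewrite /floor_digit tE /= mulnC modnMDl modn_small//.
Qed.

Lemma frac_abs_itv x : 0 <= frac_abs x < 1.
Proof.
rewrite /frac_abs; have := floor_le_tmp `|x|; have := floorD1_gt `|x|.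
by rewrite intrD subr_ge0 ltrBlDl => -> ->.
Qed.

(** The integer part contributes a multiple of b to each truncation, so digits
    can be read off |x| itself. *)
Lemma digitE x i : digit b x i = (Num.truncn (b%:R ^+ i.+1 * `|x|) %% b)%N.
Proof.
have P := floor_digit_proper (frac_abs_itv x).
have -> : digit b x = floor_digit (frac_abs x).
  rewrite /digit; case: xgetP => [a _ /= aP|/(_ _ P)//].
  exact: proper_expansion_unique (frac_abs_itv x) aP.
have fl0 : (0 <= Num.floor `|x|)%R by rewrite floor_ge0.
case E : (Num.floor `|x|) fl0 => [K|//] _.
have -> : `|x| = frac_abs x + K%:R by rewrite /frac_abs E; lra.
have /andP[f0' _] := frac_abs_itv x; move: (frac_abs x) f0' => f f0'.
rewrite /floor_digit mulrDr.
have f0 : 0 <= b%:R ^+ i.+1 * f by rewrite mulr_ge0 ?(ltW (bX_gt0 _)).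
have -> : Num.truncn (b%:R ^+ i.+1 * f + b%:R ^+ i.+1 * K%:R) =
          (Num.truncn (b%:R ^+ i.+1 * f) + b ^ i.+1 * K)%N.
  rewrite -natrX -natrM natrX.
  apply: truncn_def; have /andP[h1 h2] := truncn_itv f0.
  by rewrite natrD lerD2r h1 -addSn natrD ltrD2r h2.
by rewrite expnS -mulnA addnC mulnC modnMDl.
Qed.

(** Every digit sequence is realised: the truncated values increase to their
    supremum and stay within one unit in the last place of it. *)
Lemma digits_realized a : (forall i, (a i < b)%N) ->
  exists x, digit_enclosure b a x.
Proof.
move=> ab; pose u n : R := (digits_value b a n)%:R / b%:R ^+ n.
have u_le n m : u n <= (digits_value b a m).+1%:R / b%:R ^+ m.
  pose p := maxn n m.
  have [hn _] := digits_value_extend ab (leq_maxl n m : (n <= p)%N).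
  have [_ hm] := digits_value_extend ab (leq_maxr n m : (m <= p)%N).
  have E k q : (q <= p)%N -> k%:R / b%:R ^+ q = (k * b ^ (p - q))%:R / b%:R ^+ p :> R.
    move=> qp; rewrite -[in b%:R ^+ p](subnK qp) exprD natrM natrX.
    by field; rewrite !expf_neq0.
  rewrite /u (E _ n) ?leq_maxl// (E _ m) ?leq_maxr// ler_pM2r ?invr_gt0//.
  by rewrite ler_nat (leq_trans hn)// ltnW.
exists (sup (range u)) => n; apply/andP; split; rewrite [_ * sup _]mulrC.
  rewrite -ler_pdivrMr//; apply: ub_le_sup; last by exists n.
  by exists ((digits_value b a 0).+1%:R / b%:R ^+ 0) => _ [m _ <-]; exact: u_le.
rewrite -ler_pdivlMr//; apply: ge_sup; first by exists (u 0%N), 0%N.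
by move=> _ [m _ <-]; exact: u_le.
Qed.

End Expansions.

(** * Digit frequencies of normal numbers *)

Section NormalNumbers.
Variable R : realType.
Implicit Types (x y : R).

Lemma card_ord_sum (p : pred nat) M :
  #|[pred j : 'I_M | p j]| = (\sum_(j < M) p j)%N.
Proof.
rewrite -sum1_card big_mkcond; apply: eq_bigr => j _.
by rewrite inE; case: (p j).
Qed.

Lemma digit_freqE b d M x :
  digit_freq b d M x = (\sum_(j < M) (digit b x j == d))%N%:R / M%:R.
Proof. by rewrite /digit_freq (card_ord_sum (fun j => digit b x j == d)). Qed.

Lemma normal_digit_freq x b d : normal_numbers R x -> (2 <= b)%N -> (d < b)%N ->
  (fun M => digit_freq b d M x) @ \oo --> (b%:R^-1 : R).
Proof.
move=> nx b2 db; have := nx b b2 [:: d]; rewrite /= db => /(_ isT).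
rewrite expr1; apply: cvg_trans; apply: near_eq_cvg; apply: nearW => M.
rewrite /word_freq /digit_freq; congr (_%:R / _); apply: eq_card => j.
by rewrite -[LHS]/([:: digit b x (j + 0)] == [:: d]) eqseq_cons andbT addn0.
Qed.

(** A digit that occurs finitely often has frequency 0 instead of 1/b. *)
Lemma rare_digit_not_normal x b d N : (2 <= b)%N -> (d < b)%N ->
  (forall i, (N <= i)%N -> digit b x i != d) -> ~ normal_numbers R x.
Proof.
move=> b2 db rare nx; have b0 : 0 < b%:R :> R by rewrite ltr0n; lia.
have cnt M : (\sum_(j < M) (digit b x j == d) <= N)%N.
  rewrite (big_ord_widen_cond (M + N) predT (fun j => digit b x j == d : nat)) ?leq_addr//.
  rewrite (leq_trans _ (_ : \sum_(j < M + N) (j < N) <= N)%N)//.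
    rewrite big_mkcond; apply: leq_sum => j _.
    have [jN|/rare/negbTE->] := ltnP j N; first by case: ifP => // _; case: eqP.
    by case: ifP.
  rewrite addnC big_split_ord /= (eq_bigr (fun=> 1%N)) => [|i _]; last first.
    by rewrite ltn_ord.
  rewrite sum1_card card_ord big1 ?addn0// => i _.
  by rewrite ltnNge leq_addr.
have : b%:R^-1 <= (2 * b%:R)^-1 :> R.
  apply: (cvgr_to_le (normal_digit_freq nx b2 db)).
  exists (2 * b * N).+1 => // M /= NM; rewrite digit_freqE.
  have M0 : 0 < M%:R :> R by rewrite ltr0n; lia.
  rewrite ler_pdivrMr// ler_pdivlMl ?mulr_gt0// -!natrM ler_nat.
  by have := cnt M; nia.
rewrite lef_pV2 ?posrE ?mulr_gt0//; lra.
Qed.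

(** After N digits only zeros follow, so the digit 1 is rare. *)
Lemma integer_shift_not_normal y b N k : (2 <= b)%N -> 0 <= y ->
  b%:R ^+ N * y = k%:R -> ~ normal_numbers R y.
Proof.
move=> b2 y0 yk; apply: (@rare_digit_not_normal y b 1 N) => // i Ni.
rewrite digitE// ger0_norm//.
have -> : b%:R ^+ i.+1 * y = (b ^ (i - N) * k * b)%:R.
  by rewrite !natrM natrX -yk -[in LHS](subnK Ni) exprS exprD; ring.
by rewrite natrK modnMl.
Qed.

End NormalNumbers.

(** * A continuous map without normal values at normal points *)

(** The ternary digit written when the quinary digit r is read. A reversed cell
    is traversed from right to left, which complements the digits. *)
Definition zigzag_digit (rev : bool) (r : nat) : nat :=
  nth 0%N (if rev then [:: 2; 1; 1; 1; 0] else [:: 0; 1; 1; 1; 2])%N r.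

(** The k-th interval of length 5^-n is mapped onto the ternary interval of
    length 3^-n with left end D / 3^n, where (D, rev) is the value returned and
    rev tells whether the graph enters that interval at its right end. The
    middle passage, read at quinary digit 2, switches the direction. *)
Fixpoint zigzag_cell (n k : nat) : nat * bool :=
  if n is n'.+1 then
    let: (D, rev) := zigzag_cell n' (k %/ 5) in
    ((3 * D + zigzag_digit rev (k %% 5))%N, rev (+) (k %% 5 == 2)%N)
  else (k, false).

(** Continuity of the zigzag: the image of a cell is entered where the image of
    the preceding cell was left. *)
Lemma zigzag_cell_continuous n k :
  ((zigzag_cell n k.+1).1 + (zigzag_cell n k.+1).2 =
   (zigzag_cell n k).1 + ~~ (zigzag_cell n k).2)%N.
Proof.
elim: n k => [|n IHn] k /=; first by rewrite addn0 addn1.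
have [E|] := eqVneq (k %% 5)%N 4%N.
  have -> : (k.+1 %/ 5 = (k %/ 5).+1)%N by lia.
  have -> : (k.+1 %% 5 = 0)%N by lia.
  have := IHn (k %/ 5)%N; rewrite E.
  case: (zigzag_cell n (k %/ 5).+1) => D' r'.
  case: (zigzag_cell n (k %/ 5)) => D r /=.
  by case: r; case: r' => /=; rewrite /zigzag_digit /=; lia.
move=> ne; have -> : (k.+1 %/ 5 = k %/ 5)%N by lia.
have -> : (k.+1 %% 5 = (k %% 5).+1)%N by lia.
have : (k %% 5 < 4)%N by lia.
case: (zigzag_cell n (k %/ 5)) => D r.
case: (k %% 5)%N => [|[|[|[|]]]] //= _; case: r; rewrite /zigzag_digit /=; lia.
Qed.

Lemma zigzag_cell_near n i j : (i <= j.+1)%N -> (j <= i.+1)%N ->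
  ((zigzag_cell n i).1 <= (zigzag_cell n j).1.+1)%N.
Proof.
move=> ij ji; have := zigzag_cell_continuous n i; have := zigzag_cell_continuous n j.
have [->|[->|->]] : i = j \/ i = j.+1 \/ j = i.+1 by lia.
- by rewrite leqnSn.
- by move=> + _; do 2!case: (_.2) => /=; lia.
- by move=> _; do 2!case: (_.2) => /=; lia.
Qed.

(** The first and the last fifth of a cell are mapped to opposite outer thirds,
    hence to disjoint intervals. *)
Lemma zigzag_cell_far n k :
  ((zigzag_cell n.+1 (5 * k + 0)).1.+1 < (zigzag_cell n.+1 (5 * k + 4)).1)%N ||
  ((zigzag_cell n.+1 (5 * k + 4)).1.+1 < (zigzag_cell n.+1 (5 * k + 0)).1)%N.
Proof.
rewrite /=.
have -> : ((5 * k + 0) %/ 5 = k)%N by lia.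
have -> : ((5 * k + 4) %/ 5 = k)%N by lia.
have -> : ((5 * k + 0) %% 5 = 0)%N by lia.
have -> : ((5 * k + 4) %% 5 = 4)%N by lia.
by case: (zigzag_cell n k) => D [] /=; rewrite /zigzag_digit /=; lia.
Qed.

Section Zigzag.
Variable R : realType.
Implicit Types (x y : R).

Definition base5 x n := Num.truncn (5%:R ^+ n * x).

Let pow5 n : 0 < 5%:R ^+ n :> R. Proof. by rewrite exprn_gt0. Qed.
Let pow3 n : 0 < 3%:R ^+ n :> R. Proof. by rewrite exprn_gt0. Qed.

Definition zigzag_value x y : Prop := forall n,
  (zigzag_cell n (base5 x n)).1%:R <= 3%:R ^+ n * y
    <= (zigzag_cell n (base5 x n)).1.+1%:R.

Lemma zigzag_value_exists x : exists y, 0 <= x < 1 -> zigzag_value x y.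
Proof.
pose a i := zigzag_digit (zigzag_cell i (base5 x i)).2 (base5 x i.+1 %% 5).
have a3 i : (a i < 3)%N.
  rewrite /a; have : (base5 x i.+1 %% 5 < 5)%N by rewrite ltn_pmod.
  by case: (_ %% _)%N => [|[|[|[|[|]]]]] //; case: (zigzag_cell _ _).2.
have [y yP] := @digits_realized R 3 isT a a3.
exists y => x01 n.
suff -> : (zigzag_cell n (base5 x n)).1 = digits_value 3 a n by exact: yP.
elim: n => [|n IHn] /=.
  by rewrite /base5 expr0 mul1r; apply/eqP; rewrite truncn_eq//; case/andP: x01.
rewrite -IHn /a.
have -> : (base5 x n.+1 %/ 5)%N = base5 x n.
  by apply: (@truncn_div_expr R 5) => //; case/andP: x01.
by case: (zigzag_cell n _).
Qed.

Section ZigzagTheory.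
Variable f : R -> R.
Hypothesis fP : forall x, 0 <= x < 1 -> zigzag_value x (f x).

(** Points closer than 5^-n lie in the same or in adjacent cells of level n,
    whose images have length 3^-n and share an endpoint. *)
Lemma zigzag_modulus n x y : 0 <= x < 1 -> 0 <= y < 1 ->
  5%:R ^+ n * `|x - y| < 1 -> 3%:R ^+ n * `|f x - f y| <= 2.
Proof.
move=> x01 y01 xy.
have tr z : 0 <= z < 1 -> (base5 z n)%:R <= 5%:R ^+ n * z < (base5 z n).+1%:R.
  by move=> /andP[z0 _]; apply: truncn_itv; rewrite mulr_ge0// ltW.
have /andP[x1 x2] := tr _ x01; have /andP[y1 y2] := tr _ y01.
have /andP[fx1 fx2] := fP x01 n; have /andP[fy1 fy2] := fP y01 n.
move: xy; rewrite -{1}(gtr0_norm (pow5 n)) -normrM mulrBr.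
rewrite -{1}(gtr0_norm (pow3 n)) -normrM mulrBr.
move: (5%:R ^+ n * x) (5%:R ^+ n * y) (3%:R ^+ n * f x) (3%:R ^+ n * f y)
  x1 x2 y1 y2 fx1 fx2 fy1 fy2 => X Y FX FY x1 x2 y1 y2 fx1 fx2 fy1 fy2.
rewrite ltr_norml => /andP[h1 h2].
set i := base5 x n in x1 x2 fx1 fx2 *; set j := base5 y n in y1 y2 fy1 fy2 *.
clearbody i j.
have ij : (i <= j.+1)%N.
  rewrite -ltnS -(ltr_nat R) -[j.+2]addn1 natrD; lra.
have ji : (j <= i.+1)%N.
  rewrite -ltnS -(ltr_nat R) -[i.+2]addn1 natrD; lra.
have d1 := zigzag_cell_near n ij ji; have d2 := zigzag_cell_near n ji ij.
move: d1 d2; rewrite -!(ler_nat R) -!natr1 in fx2 fy2 * => d1 d2.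
by rewrite ler_norml; apply/andP; split; lra.
Qed.

Lemma zigzag_continuous : {within `]0, 1[%classic, continuous f}.
Proof.
rewrite continuous_open_subspace; last exact: interval_open.
move=> x; rewrite inE /= in_itv /= => /andP[x0 x1].
apply/cvgrPdist_le => e e0; near \oo => n.
have en : 2 / 3%:R ^+ n <= e.
  have : 3%:R^-1 ^+ n <= e / 2.
    near: n; have e20 : 0 < e / 2 by rewrite divr_gt0.
    have /cvgrPdist_le /(_ _ e20) : (fun n => (3%:R^-1 : R) ^+ n) @ \oo --> (0 : R).
      by apply: cvg_expr; rewrite ger0_norm ?invr_ge0// invf_lt1// ltr1n.
    apply: filterS => n; rewrite sub0r normrN ger0_norm// exprn_ge0// invr_ge0//.
  by rewrite exprVn; lra.
near=> y.
have /andP[y0 y1] : 0 < y < 1.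
  have : y \in `]0, 1[ by near: y; apply: near_in_itvoo; rewrite in_itv /= x0.
  by rewrite in_itv.
have xy : `|x - y| < 5%:R ^- n.
  by near: y; apply/nbhs_ballP; exists (5%:R ^- n); rewrite //= invr_gt0.
apply: le_trans en; rewrite ler_pdivlMr// mulrC; apply: zigzag_modulus.
- by rewrite ltW.
- by rewrite ltW.
- by rewrite -ltr_pdivlMl// mulr1.
Unshelve. all: by end_near.
Qed.

(** Inside each small cell f takes two distinct values by [zigzag_cell_far], and
    one of them differs from f t. *)
Lemma zigzag_nowhere_constant : nowhere_constant `]0, 1[%classic f.
Proof.
move=> t; rewrite /= in_itv /= => /andP[t0 t1] e e0.
have [n [en tn t'n]] : exists n, [/\ 5%:R ^- n < e, 5%:R ^- n < t & 5%:R ^- n < 1 - t].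
  have m0 : 0 < Num.min e (Num.min t (1 - t)) by rewrite !lt_min e0 t0 subr_gt0.
  have : (fun n => (5%:R^-1 : R) ^+ n) @ \oo --> (0 : R).
    by apply: cvg_expr; rewrite ger0_norm ?invr_ge0// invf_lt1// ltr1n.
  move=> /cvgrPdist_lt /(_ _ m0) [n _ /(_ n (leqnn n)) /=].
  rewrite sub0r normrN ger0_norm ?exprn_ge0 ?invr_ge0//.
  by rewrite exprVn !lt_min => /and3P[? ? ?]; exists n.
have tge : 0 <= 5%:R ^+ n * t by rewrite mulr_ge0// ltW.
have /andP[] := truncn_itv tge; move: (Num.truncn _) => k k1 k2.
have pt j : (j <= 4)%N -> exists2 u : R, `]0, 1[%classic u /\ `|u - t| < e &
    base5 u n.+1 = (5 * k + j)%N.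
  move=> j4; pose u : R := 5%:R ^- n.+1 * (5 * k + j)%N%:R.
  have uE : 5%:R ^+ n.+1 * u = (5 * k + j)%N%:R.
    by rewrite /u mulrA divff ?mul1r// gt_eqF.
  have uE' : 5%:R ^+ n * u = k%:R + j%:R / 5%:R.
    have : 5%:R * (5%:R ^+ n * u) = (5 * k + j)%N%:R.
      by rewrite -uE exprS mulrA.
    by rewrite natrD natrM => h; lra.
  have j0 : 0 <= j%:R / 5%:R :> R by rewrite divr_ge0.
  have j1 : j%:R / 5%:R < 1 :> R by rewrite ltr_pdivrMr// mul1r ltr_nat.
  have ut : `|u - t| < 5%:R ^- n.
    rewrite -[_ ^- n]mulr1 ltr_pdivlMl// -{1}(gtr0_norm (pow5 n)) -normrM mulrBr.
    rewrite uE' ltr_norml; clear uE uE'; clearbody u.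
    move: k2 j0 j1; rewrite -[k.+1%:R]natr1 => k2.
    move: (j%:R / 5%:R) (5%:R ^+ n * t) k1 k2 => z w k1 k2 z0 z1.
    by apply/andP; split; lra.
  exists u; last by rewrite /base5 uE natrK.
  clearbody u.
  split; last exact: lt_trans ut en.
  by move: ut; rewrite ltr_norml /= in_itv /= => /andP[? ?]; apply/andP; split; lra.
have [u [u01 ut] uE] := pt 0%N isT; have [v [v01 vt] vE] := pt 4%N isT.
have itv (w : R) : `]0, 1[%classic w -> 0 <= w < 1.
  by rewrite /= in_itv /= => /andP[/ltW -> ->].
have uv : f u <> f v.
  move=> fuv; have /andP[u1 u2] := fP (itv _ u01) n.+1.
  have /andP[v1 v2] := fP (itv _ v01) n.+1.
  rewrite fuv in u1 u2; have := le_trans v1 u2; have := le_trans u1 v2.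
  rewrite uE vE !ler_nat => h1 h2; have := zigzag_cell_far n k.
  by rewrite ltnNge h2 ltnNge h1.
have [fut|fut] := pselect (f u = f t); last by exists u.
by exists v; split=> // fvt; apply: uv; rewrite fut fvt.
Qed.

(** The digits of f x are the ones written by the zigzag unless f x is the right
    end of one of its enclosing intervals, in which case it is rational with a
    power of 3 as denominator and not normal anyway. *)
Lemma zigzag_not_normal x : 0 < x < 1 -> normal_numbers R x ->
  ~ normal_numbers R (f x).
Proof.
move=> /andP[x0 x1] nx ny; have x01 : 0 <= x < 1 by rewrite ltW.
have y0 : 0 <= f x.
  have /andP[+ _] := fP x01 0; rewrite expr0 mul1r; exact: le_trans.
have D_trunc n : Num.truncn (3%:R ^+ n * f x) = (zigzag_cell n (base5 x n)).1.
  have /andP[h1 h2] := fP x01 n; apply: truncn_def.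
  rewrite h1 /= lt_neqAle h2 andbT; apply/eqP => e.
  exact: (@integer_shift_not_normal R (f x) 3 n _ isT y0 e ny).
have dE j : (digit 3 (f x) j == 1%N) =
    ((digit 5 x j == 1) + (digit 5 x j == 2) + (digit 5 x j == 3))%N :> nat.
  rewrite !digitE// !ger0_norm ?(ltW x0)// -/(base5 x j.+1).
  rewrite D_trunc /=.
  case: (zigzag_cell j _) => D r; rewrite mulnC modnMDl.
  have : (base5 x j.+1 %% 5 < 5)%N by rewrite ltn_pmod.
  by case: (_ %% 5)%N => [|[|[|[|[|]]]]] //; case: r.
have h3 := normal_digit_freq ny (isT : (2 <= 3)%N) (isT : (1 < 3)%N).
have h5 d (d5 : (d < 5)%N) := normal_digit_freq nx (isT : (2 <= 5)%N) d5.
have hF : (fun M => digit_freq 3 1 M (f x)) @ \oo -->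
    (5%:R^-1 + 5%:R^-1 + 5%:R^-1 : R).
  apply: cvg_trans (cvgD (cvgD (h5 1%N isT) (h5 2%N isT)) (h5 3%N isT)).
  apply: near_eq_cvg; apply: nearW => M /=.
  rewrite !fctE !digit_freqE -!mulrDl -!natrD.
  congr (_%:R / _); rewrite -!big_split /=; apply: eq_bigr => j _.
  by rewrite dE.
have h : 3%:R^-1 = 5%:R^-1 + 5%:R^-1 + 5%:R^-1 :> R.
  by have := cvg_unique (@Rhausdorff R) h3 hF; exact.
lra.
Qed.

End ZigzagTheory.

Lemma normal_not_super_dense : ~ super_dense (normal_numbers R).
Proof.
move=> sd; have [f fP] := choice zigzag_value_exists.
have [] : (f @` (`]0, 1[%classic `&` normal_numbers R)) `&` normal_numbers R
    !=set0.
  apply: sd (zigzag_continuous fP) (zigzag_nowhere_constant fP).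
  - exact: interval_open.
  - exact: interval_is_interval.
  - by exists (2^-1); rewrite /= in_itv /=; lra.
move=> y [[x [x01 nx] fx] ny].
move: x01; rewrite /= in_itv /= => x01.
by apply: (zigzag_not_normal fP x01 nx); rewrite fx.
Qed.

End Zigzag.

(** * Super-density of residual sets *)

Section SuperDense.
Variable R : realType.
Implicit Types (x y : R) (A B : set R).

Lemma open_dist_subset A x : open A -> A x ->
  exists2 r : R, 0 < r & forall y, `|y - x| < r -> A y.
Proof.
move=> oA Ax; have /nbhs_ballP[r r0 rA] := open_nbhs_nbhs (conj oA Ax).
by exists r => // y yx; apply: rA; rewrite /ball /= distrC.
Qed.

(** A nowhere constant continuous function maps each subinterval onto a
    nondegenerate interval, so preimages of dense open sets are dense open in
    the domain and Baire's theorem applies to both copies of the residual set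
    at once. *)
Lemma comeager_super_dense (O : nat -> set R) A :
  (forall n, open (O n)) -> (forall n, dense (O n)) ->
  \bigcap_n O n `<=` A -> super_dense A.
Proof.
move=> oO dO OA I phi oI itvI [t0 It0] cphi nc.
(* The exterior of I is added to make the preimages dense in the whole line. *)
pose G n := (I `&` phi @^-1` O n) `|` ~` closure I.
have oG n : open (G n).
  apply: openU; last by rewrite openC; exact: closed_closure.
  apply: (continuous_inP phi oI).1; last exact: oO.
  by rewrite -continuous_open_subspace.
have dG n : dense (G n).
  move=> D [d Dd] oD.
  have [[e De Ie]|DI] := pselect (exists2 d, D d & I d); last first.
    exists d; split=> //; right=> /(_ D (open_nbhs_nbhs (conj oD Dd))).
    by move=> [z [Iz Dz]]; apply: DI; exists z.
  have [r r0 rD] := open_dist_subset oD De.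
  have [t [It te pte]] := nc _ Ie _ r0.
  pose a := Num.min e t; pose b := Num.max e t.
  have ab : a <= b by rewrite ge_min le_max lexx.
  have abD z : a <= z <= b -> D z /\ I z.
    rewrite /a /b => zab; split.
      apply: rD; move: zab te.
      by case: (leP e t) => et /andP[? ?]; rewrite !ltr_norml => /andP[? ?];
        apply/andP; split; lra.
    by move: zab; case: (leP e t) => et zab; apply: itvI zab.
  have cab : {within `[a, b], continuous phi}.
    apply: continuous_subspaceW cphi => z; rewrite /= in_itv /= => zab.
    exact: (abD z zab).2.
  have mM : Num.min (phi a) (phi b) < Num.max (phi a) (phi b).
    have ne : phi a != phi b.
      rewrite /a /b; case: (leP e t) => _; last exact/eqP.
      by rewrite eq_sym; exact/eqP.
    by case: (ltgtP (phi a) (phi b)) ne.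
  have [v [/= vm Ov]] : `]Num.min (phi a) (phi b), Num.max (phi a) (phi b)[%classic
      `&` O n !=set0.
    apply: dO; last exact: interval_open.
    exists ((Num.min (phi a) (phi b) + Num.max (phi a) (phi b)) / 2).
    by rewrite /= in_itv /= !midf_lt.
  have vmM : Num.min (phi a) (phi b) <= v <= Num.max (phi a) (phi b).
    by move: vm; rewrite in_itv /= => /andP[/ltW -> /ltW ->].
  have [c cab' cv] := IVT ab cab vmM; move: cab'; rewrite in_itv /= => cab'.
  have [Dc Ic] := abD _ cab'.
  by exists c; split=> //; left; split=> //=; rewrite cv.
have [t [It tOG]] : I `&` \bigcap_n (O n `&` G n) !=set0.
  apply: Baire => //; last by exists t0.
  by move=> n; split; [exact: openI|exact: denseI].
exists (phi t); split; last first.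
  apply: OA => n _; have [_ [[]//|]] := tOG n Logic.I.
  by move=> /(_ (subset_closure It)).
by exists t => //; split=> //; apply: OA => n _; have [] := tOG n Logic.I.
Qed.

Section DenseZeroBlocks.
Variable b : nat.
Hypothesis b_ge2 : (2 <= b)%N.

Let b_gt0 : 0 < b%:R :> R. Proof. by rewrite ltr0n; lia. Qed.
Let bX_gt0 n : 0 < b%:R ^+ n :> R. Proof. by rewrite exprn_gt0. Qed.

(** Strict inequalities make this set open. If b^M |x| lies within b^(-mM) to
    the right of an integer, then the digits of index M, ..., (m+1)M - 1 of x
    vanish. *)
Definition zero_block m : set R :=
  [set x | exists M k, (m < M)%N /\
     0 < b%:R ^+ M * `|x| - k%:R < (b%:R ^+ (m * M))^-1].

Lemma open_zero_block m : open (zero_block m).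
Proof.
have -> : zero_block m = \bigcup_(M in [set M | (m < M)%N]) \bigcup_k
    ((fun x : R => b%:R ^+ M * `|x| - k%:R) @^-1`
      [set` `]0, (b%:R ^+ (m * M))^-1[]).
  apply/seteqP; split=> x.
    by move=> [M [k [mM h]]]; exists M => //; exists k => //=; rewrite in_itv.
  by move=> [M mM [k _ /=]]; rewrite in_itv /= => h; exists M, k.
apply: bigcup_open => M _; apply: bigcup_open => k _.
apply: open_comp; last exact: interval_open.
move=> x _; apply: cvgB; last exact: cvg_cst.
by apply: cvgM; [exact: cvg_cst|exact: norm_continuous].
Qed.

Lemma expr_inv_small (e : R) : 0 < e -> exists N, forall n, (N <= n)%N ->
  (b%:R ^+ n)^-1 < e.
Proof.
move=> e0; have : (fun n => (b%:R^-1 : R) ^+ n) @ \oo --> (0 : R).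
  by apply: cvg_expr; rewrite ger0_norm ?invr_ge0 ?ltW// invf_lt1// ltr1n.
move=> /cvgrPdist_lt /(_ _ e0) [N _ Nn]; exists N => n /Nn /=.
by rewrite sub0r normrN ger0_norm ?exprn_ge0 ?invr_ge0 ?ltW// exprVn.
Qed.

Lemma dense_zero_block m : dense (zero_block m).
Proof.
move=> D [d Dd] oD; have [r r0 rD] := open_dist_subset oD Dd.
have [N NP] : exists N, forall n, (N <= n)%N -> (b%:R ^+ n)^-1 < r / 2.
  by apply: expr_inv_small; rewrite divr_gt0.
pose M := (maxn m N).+1.
have Mr : (b%:R ^+ M)^-1 < r / 2 by apply: NP; rewrite leqW// leq_maxr.
(* Rounding up keeps z positive, so that -z has absolute value z. *)
pose k := (Num.truncn (b%:R ^+ M * `|d|)).+1.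
pose w : R := (b%:R ^+ (m * M))^-1 / 2.
have w0 : 0 < w by rewrite divr_gt0// invr_gt0.
have w1 : w < 1.
  have : (b%:R ^+ (m * M))^-1 <= 1 :> R.
    by rewrite invf_le1// exprn_ege1// ler1n; lia.
  rewrite /w; lra.
pose z : R := (k%:R + w) / b%:R ^+ M.
have z0 : 0 < z by rewrite divr_gt0// ltr_pwDr.
have zE : b%:R ^+ M * z = k%:R + w by rewrite mulrC divfK// gt_eqF.
have zd : `|z - `|d| | < r.
  have -> : z - `|d| = (b%:R ^+ M * z - b%:R ^+ M * `|d|) / b%:R ^+ M.
    by rewrite -mulrBr mulrC mulKf// gt_eqF.
  rewrite zE normrM [X in _ * X]gtr0_norm ?invr_gt0//.
  have /truncn_itv : 0 <= b%:R ^+ M * `|d| by rewrite mulr_ge0// ltW.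
  rewrite -/k /k -natr1.
  set t := Num.truncn _; move: (t%:R : R) (b%:R ^+ M * `|d|) => t' p /andP[p1 p2].
  rewrite -[ltRHS](_ : 2 * (r / 2) = r); last by lra.
  apply: ltr_pM => //; rewrite ?invr_ge0 ?(ltW (bX_gt0 _))//.
  by rewrite ltr_norml; apply/andP; split; lra.
pose x := if 0 <= d then z else - z.
have xE : `|x| = z by rewrite /x; case: ifP => _; rewrite ?normrN gtr0_norm.
exists x; split; last first.
  exists M, k; split; first by rewrite ltnS leq_maxl.
  rewrite xE zE [k%:R + w]addrC addrK w0 /w ltr_pdivrMr// ltr_pMr ?invr_gt0//.
  by rewrite ltr1n.
apply: rD; rewrite /x; case: (ger0P d) zd => d0; first by [].
by rewrite -normrN; congr (`|_| < _); ring.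
Qed.

Lemma digit_zero_block m M k x i :
  0 < b%:R ^+ M * `|x| - k%:R < (b%:R ^+ (m * M))^-1 ->
  (i < m * M)%N -> digit b x (M + i) = 0%N.
Proof.
move=> /andP[h1 h2] im; rewrite digitE//.
have -> : b%:R ^+ (M + i).+1 * `|x| = b%:R ^+ i.+1 * (b%:R ^+ M * `|x|).
  by rewrite mulrA -exprD addSn addnC.
have -> : Num.truncn (b%:R ^+ i.+1 * (b%:R ^+ M * `|x|)) = (b ^ i * k * b)%N.
  have E : (b ^ i * k * b)%:R = b%:R ^+ i.+1 * k%:R :> R.
    by rewrite !natrM natrX exprS; ring.
  apply: truncn_def; rewrite -natr1 E ler_pM2l//; apply/andP; split; first by lra.
  rewrite -ltrBlDl -mulrBr -[ltRHS](@mulfV _ (b%:R ^+ i.+1)) ?gt_eqF//.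
  rewrite ltr_pM2l// (lt_le_trans h2)// lef_pV2 ?posrE//.
  by rewrite ler_eXn2l// ltr1n.
by rewrite modnMl.
Qed.

Lemma digit_freq_le1 d M x : digit_freq b d M x <= 1.
Proof.
rewrite /digit_freq; case: M => [|M]; first by rewrite invr0 mulr0.
rewrite ler_pdivrMr// mul1r ler_nat.
by rewrite -[X in (_ <= X)%N]card_ord max_card.
Qed.

Lemma zero_blocks_Zset : \bigcap_m zero_block m `<=` Zset R b.
Proof.
move=> x xO; rewrite /Zset /= limn_esup_lim.
suff -> : esups (fun M => (digit_freq b 0 M x)%:E) = cst 1%E by exact: lim_cst.
apply/funext => n; apply/eqP; rewrite eq_le; apply/andP; split.
  by apply: ub_ereal_sup => _ [M _ <-]; rewrite lee_fin digit_freq_le1.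
apply/lee_subgt0Pr => e e0.
(* Of the first (m + 1) M digits at least m M vanish, and 1 / (m + 1) < e. *)
pose m := maxn n (Num.truncn e^-1).
have em : e^-1 < m.+1%:R.
  by apply: lt_le_trans (truncnS_gt _) _; rewrite ler_nat ltnS leq_maxr.
have [M [k [mM h]]] := xO m Logic.I.
apply: (@le_trans _ _ (digit_freq b 0 (M + m * M) x)%:E); last first.
  apply: ereal_sup_ubound; exists (M + m * M)%N => //=.
  by rewrite (leq_trans (leq_maxl _ _ : (n <= m)%N))// (leq_trans (ltnW mM))// leq_addr.
rewrite lee_fin digit_freqE.
have cnt : (m * M <= \sum_(j < M + m * M) (digit b x j == 0%N))%N.
  rewrite big_split_ord /= (leq_trans _ (leq_addl _ _))//.
  rewrite (eq_bigr (fun=> 1%N)) => [|i _]; last by rewrite (digit_zero_block h).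
  by rewrite sum1_card card_ord.
have M0 : 0 < M%:R :> R by rewrite ltr0n; lia.
have S0 : 0 < (M + m * M)%N%:R :> R by rewrite ltr0n; lia.
rewrite ler_pdivlMr//; apply: le_trans (_ : (m * M)%N%:R <= _); last first.
  by rewrite ler_nat.
have e1 : 1 < e * m.+1%:R by rewrite -ltr_pdivrMl// mulr1.
have -> : (M + m * M)%N%:R = M%:R * m.+1%:R :> R.
  by rewrite -natrM; congr (_%:R); lia.
have -> : (m * M)%N%:R = M%:R * (m.+1%:R - 1) :> R.
  by rewrite -natr1 addrK natrM mulrC.
rewrite mulrCA ler_pM2l//; lra.
Qed.

Lemma Zset_super_dense : super_dense (Zset R b).
Proof.
exact: comeager_super_dense open_zero_block dense_zero_block zero_blocks_Zset.
Qed.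

Lemma Zset_not_normal : Zset R b `<=` ~` normal_numbers R.
Proof.
move=> x; rewrite /Zset /= => x1 nx.
have h := normal_digit_freq nx b_ge2 (ltnW b_ge2).
have hE : (fun M => (digit_freq b 0 M x)%:E) @ \oo --> (b%:R^-1 : R)%:E.
  by apply: cvg_EFin; [exact: nearW|exact: h].
have [_] := cvg_limn_einf_sup hE; rewrite x1 => -[] /eqP.
by rewrite eq_sym invr_eq1 -[1]/(1%:R) eqr_nat; lia.
Qed.

End DenseZeroBlocks.

Lemma super_denseS A B : A `<=` B -> super_dense A -> super_dense B.
Proof.
move=> AB sA I phi oI iI I0 cphi nphi.
have [y [[x [Ix Ax] xy] Ay]] := sA _ _ oI iI I0 cphi nphi.
by exists y; split; [exists x => //; split=> //; exact: AB|exact: AB].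
Qed.

Lemma nonnormal_super_dense : super_dense (~` normal_numbers R).
Proof.
exact: super_denseS (@Zset_not_normal 2 isT) (@Zset_super_dense 2 isT).
Qed.

End SuperDense.

(** * Sets of Hausdorff measure zero *)

Section HausdorffNull.
Variable R : realType.
Implicit Types (x y : R) (s r : R) (U A : set R).

Lemma diam_ge0 U : (0 <= diam U)%E.
Proof. by apply: ereal_sup_ubound; left. Qed.

Lemma diam_le r U : 0 <= r -> (forall x y, U x -> U y -> `|x - y| <= r) ->
  (diam U <= r%:E)%E.
Proof.
move=> r0 Ur; apply: ub_ereal_sup => _ [->|[[x y] [/= Ux Uy] <-]].
  by rewrite lee_fin.
by rewrite lee_fin Ur.
Qed.

Lemma dist_le_diam U x y : U x -> U y -> (`|x - y|%:E <= diam U)%E.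
Proof. by move=> Ux Uy; apply: ereal_sup_ubound; right; exists (x, y). Qed.

Lemma diam_set0 : diam set0 = 0%E :> \bar R.
Proof. by apply/eqP; rewrite eq_le diam_ge0 andbT; apply: diam_le. Qed.

Lemma diam_pow_ge0 s U : (0 <= diam_pow s U)%E.
Proof. by rewrite /diam_pow; case: ifP => // _; exact: poweR_ge0. Qed.

Lemma diam_pow_set0 s : diam_pow s set0 = 0%E.
Proof. by rewrite /diam_pow eqxx. Qed.

Lemma diam_pow_le s r U : 0 <= s -> 0 <= r -> (diam U <= r%:E)%E ->
  (diam_pow s U <= (r `^ s)%:E)%E.
Proof.
move=> s0 r0 Ur; rewrite /diam_pow; case: ifP => _; first by rewrite lee_fin powR_ge0.
rewrite -poweR_EFin; apply: gt0_ler_poweR => //.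
  by rewrite in_itv /= diam_ge0 leey.
by rewrite in_itv /= lee_fin r0 leey.
Qed.

Lemma hausdorff_nullP s A : hausdorff_measure s A = 0%E <->
  forall delta e : R, 0 < delta -> 0 < e -> exists U : nat -> set R,
    [/\ A `<=` \bigcup_i U i, forall i, (diam (U i) <= delta%:E)%E &
        (\sum_(0 <= i <oo) diam_pow s (U i) <= e%:E)%E].
Proof.
split=> [A0 delta e d0 e0|cov].
  have : (hausdorff_content s delta A < e%:E)%E.
    apply: (@le_lt_trans _ _ 0%E); last by rewrite lte_fin.
    by rewrite -A0; apply: ereal_sup_ubound; exists delta.
  by move=> /ereal_inf_lt[_ [U [AU dU] <-] /ltW Ue]; exists U.
apply/eqP; rewrite eq_le; apply/andP; split.
  apply: ub_ereal_sup => _ [delta /= d0 <-]; apply/lee_addgt0Pr => e e0.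
  rewrite add0e; have [U [AU dU Ue]] := cov _ _ d0 e0.
  by apply: le_trans Ue; apply: ereal_inf_lbound; exists U.
apply: le_trans (ereal_sup_ubound _); last by exists 1 => //=.
apply: le_ereal_inf_tmp => _ [U _ <-].
by apply: nneseries_ge0 => i _ _; exact: diam_pow_ge0.
Qed.

Lemma nneseries_pairing (f : nat -> nat -> \bar R) :
  (forall i j, (0 <= f i j)%E) -> exists e : nat -> nat * nat,
    (forall p, exists i, e i = p) /\
    (\sum_(0 <= i <oo) f (e i).1 (e i).2 =
     \sum_(0 <= i <oo) \sum_(0 <= j <oo) f i j)%E.
Proof.
move=> f0; have : ([set: nat] #= [set: nat * nat])%card.
  by rewrite card_eq_sym; exact: card_nat2.
move=> /card_set_bijP[e be]; exists e; split.
  by move=> p; have [_ _ /(_ p Logic.I)[i _ <-]] := be; exists i.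
rewrite nneseries_esumT// nneseries_esumT; last by move=> i; exact: nneseries_ge0.
under [RHS]eq_esum do rewrite nneseries_esumT//.
rewrite esum_esum// -(reindex_esum _ [set: nat * nat] _ (fun p => f p.1 p.2) be).
by congr (esum _ _); apply/seteqP; split.
Qed.

(** Covers indexed by pairs can be renumbered by a single integer. *)
Lemma hausdorff_null_double s A :
  (forall delta e : R, 0 < delta -> 0 < e -> exists U : nat -> nat -> set R,
    [/\ forall x, A x -> exists i j, U i j x,
        forall i j, (diam (U i j) <= delta%:E)%E &
        (\sum_(0 <= i <oo) \sum_(0 <= j <oo) diam_pow s (U i j) <= e%:E)%E]) ->
  hausdorff_measure s A = 0%E.
Proof.
move=> cov; apply/hausdorff_nullP => delta e d0 e0.
have [U [AU dU Ue]] := cov _ _ d0 e0.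
have [g [gsurj gE]] := nneseries_pairing (fun i j => diam_pow_ge0 s (U i j)).
exists (fun i => U (g i).1 (g i).2); split=> // [x /AU[i [j Ux]]|].
  by have [k gk] := gsurj (i, j); exists k => //; rewrite gk.
by rewrite gE.
Qed.

Lemma hausdorff_null_bigcup s A (B : nat -> set R) :
  A `<=` \bigcup_n B n -> (forall n, hausdorff_measure s (B n) = 0%E) ->
  hausdorff_measure s A = 0%E.
Proof.
move=> AB B0; apply: hausdorff_null_double => delta e d0 e0.
have en n : 0 < e / (2 ^ n.+1)%:R by rewrite divr_gt0// ltr0n expn_gt0.
have /choice[U UP] n := (hausdorff_nullP s (B n)).1 (B0 n) _ _ d0 (en n).
exists U; split.
- by move=> x /AB[n _ Bx]; have [/(_ x Bx)[i _ Ux] _ _] := UP n; exists n, i.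
- by move=> n i; have [_ + _] := UP n; exact.
- apply: le_trans (epsilon_trick0 xpredT (ltW e0)).
  apply: lee_nneseries => [n _ _|n _].
    by apply: nneseries_ge0 => *; exact: diam_pow_ge0.
  by have [_ _] := UP n.
Qed.

Lemma nneseries_le_bound (f : nat -> \bar R) (B : \bar R) :
  (forall n, 0 <= f n)%E -> (forall n, \sum_(0 <= i < n) f i <= B)%E ->
  (\sum_(0 <= i <oo) f i <= B)%E.
Proof.
move=> f0 fB; apply: lime_le; first exact: is_cvg_nneseries.
exact: nearW.
Qed.

End HausdorffNull.

Section AdicCells.
Variables (R : realType) (b : nat).
Hypothesis b_ge2 : (2 <= b)%N.

Let b_gt0 : 0 < b%:R :> R. Proof. by rewrite ltr0n; lia. Qed.
Let bX_gt0 n : 0 < b%:R ^+ n :> R. Proof. by rewrite exprn_gt0. Qed.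

Definition adic_cell (neg : bool) (M k : nat) : set R :=
  [set x | (x < 0) = neg /\ Num.truncn (b%:R ^+ M * `|x|) = k].

Lemma diam_adic_cell neg M k :
  (diam (adic_cell neg M k) <= ((b%:R ^+ M)^-1)%:E)%E.
Proof.
apply: diam_le => [|x y]; first by rewrite invr_ge0 ltW.
move=> [xn xk] [yn yk]; have -> : `|x - y| = `| `|x| - `|y| |.
  case: (ltrP x 0) xn => x0 xn; case: (ltrP y 0) yn => y0 yn.
  - by rewrite (ltr0_norm x0) (ltr0_norm y0) -normrN; congr `|_|; ring.
  - by move: yn; rewrite -xn.
  - by move: yn; rewrite -xn.
  - by rewrite (ger0_norm x0) (ger0_norm y0).
rewrite -[leRHS]mulr1 ler_pdivlMl// -[X in X * _](gtr0_norm (bX_gt0 M)) -normrM mulrBr.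
have /andP[] : (Num.truncn (b%:R ^+ M * `|x|))%:R <= b%:R ^+ M * `|x| <
    (Num.truncn (b%:R ^+ M * `|x|)).+1%:R.
  by apply: truncn_itv; rewrite mulr_ge0// ltW.
have /andP[] : (Num.truncn (b%:R ^+ M * `|y|))%:R <= b%:R ^+ M * `|y| <
    (Num.truncn (b%:R ^+ M * `|y|)).+1%:R.
  by apply: truncn_itv; rewrite mulr_ge0// ltW.
rewrite xk yk -natr1; move: (b%:R ^+ M * _) (b%:R ^+ M * _) => p q h1 h2 h3 h4.
by rewrite ler_norml; apply/andP; split; lra.
Qed.

Lemma truncn_div_exprn (x : R) M : 0 <= x ->
  (Num.truncn (b%:R ^+ M * x) %/ b ^ M)%N = Num.truncn x.
Proof.
move=> x0; elim: M => [|M IHM]; first by rewrite expr0 mul1r expn0 divn1.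
by rewrite expnS divnMA (truncn_div_expr b_ge2 M x0).
Qed.

Lemma powR_inv_exprn (s : R) M :
  ((b%:R ^+ M)^-1) `^ s = (b%:R `^ (- s)) ^+ M :> R.
Proof.
rewrite -powR_mulrn ?powR_ge0// -powRrM mulNr powRN -powR_inv1 ?exprn_ge0 ?ltW//.
rewrite -powR_mulrn ?ltW// -!powRrM -powRN; congr (_ `^ _); ring.
Qed.

(** Box counting along infinitely many scales: if each point of A is caught, at
    arbitrarily fine levels M, by one of few enough b-adic cells of size b^-M,
    the selected cells of levels beyond m have s-weights bounded by the tail of
    a geometric series. *)
Lemma hausdorff_null_cells (s q : R) (sel : nat -> nat -> bool) (A : set R) :
  0 <= s -> 0 < q < 1 ->
  (forall K M, (\sum_(k < b ^ M) sel M (K * b ^ M + k))%N%:R *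
               (b%:R `^ (- s)) ^+ M <= q ^+ M) ->
  (forall x m, A x -> exists2 M, (m <= M)%N &
     sel M (Num.truncn (b%:R ^+ M * `|x|))) ->
  hausdorff_measure s A = 0%E.
Proof.
move=> s0 /andP[q0 q1] selq Asel.
(* Only finitely many cells of each level lie in a unit interval of given sign,
   so A is first split into such pieces; n encodes the sign and the interval. *)
pose P n : set R := A `&` adic_cell (odd n) 0 n./2.
apply: (@hausdorff_null_bigcup _ s A P).
  move=> x Ax; pose K := Num.truncn (b%:R ^+ 0 * `|x|).
  exists ((x < 0)%R + K.*2)%N => //; split=> //; split; last by rewrite half_bit_double.
  by rewrite oddD odd_double addbF oddb.
move=> n; apply: hausdorff_null_double => delta e d0 e0.
set neg := odd n; set K := n./2.
have [N NP] := expr_inv_small b_ge2 d0.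
have [N' N'P] : exists N', forall m, (N' <= m)%N -> q ^+ m / (1 - q) <= e.
  have : (fun m => q ^+ m / (1 - q)) @ \oo --> (0 / (1 - q)).
    by apply: cvgM; [apply: cvg_expr; rewrite ger0_norm// ltW|exact: cvg_cst].
  rewrite mul0r => /cvgrPdist_le /(_ _ e0) [N' _ h]; exists N' => m /h /=.
  by rewrite sub0r normrN; exact: le_trans (ler_norm _).
pose m := maxn N N'.
pose U M k := if [&& m <= M, k < b ^ M & sel M (K * b ^ M + k)]%N
  then adic_cell neg M (K * b ^ M + k) else set0.
exists U; split.
- move=> x [Ax [xn xK]]; have [M mM Msel] := Asel x m Ax.
  exists M, (Num.truncn (b%:R ^+ M * `|x|) %% b ^ M)%N.
  have E : (K * b ^ M + Num.truncn (b%:R ^+ M * `|x|) %% b ^ M =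
            Num.truncn (b%:R ^+ M * `|x|))%N.
    rewrite expr0 mul1r in xK.
    by rewrite [RHS](divn_eq _ (b ^ M)) truncn_div_exprn// xK.
  by rewrite /U E mM Msel ltn_pmod ?expn_gt0 ?(ltnW b_ge2).
- move=> M k; rewrite /U; case: ifP => [/andP[mM _]|_]; last first.
    by rewrite diam_set0 lee_fin ltW.
  apply: le_trans (diam_adic_cell _ _ _) _.
  by rewrite lee_fin ltW// NP// (leq_trans (leq_maxl _ _) mM).
have UM M : (\sum_(0 <= k <oo) diam_pow s (U M k) <=
             (if (m <= M)%N then q ^+ M else 0)%:E)%E.
  apply: nneseries_le_bound => [k|l]; first exact: diam_pow_ge0.
  case: ifP => mM; last first.
    by rewrite big1// => k _; rewrite /U mM diam_pow_set0.
  apply: le_trans (_ : (\sum_(0 <= k < maxn l (b ^ M)) diam_pow s (U M k) <= _)%E).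
    rewrite [leRHS](big_cat_nat (leq0n l) (leq_maxl _ _))//=.
    by rewrite leeDl// sume_ge0// => *; exact: diam_pow_ge0.
  rewrite (big_cat_nat (leq0n (b ^ M)) (leq_maxr _ _))//= [X in (_ + X)%E]big1_seq.
    rewrite adde0; apply: (@le_trans _ _ ((\sum_(k < b ^ M) sel M (K * b ^ M + k))%N%:R *
               (b%:R `^ (- s)) ^+ M)%:E); last by rewrite lee_fin.
    rewrite big_mkord natr_sum mulr_suml -sumEFin; apply: lee_sum => k _.
    rewrite /U mM ltn_ord /=; case: ifP => _; last by rewrite diam_pow_set0 mul0r.
    rewrite mul1r -powR_inv_exprn; apply: (diam_pow_le s0 _ (diam_adic_cell _ _ _)).
    by rewrite invr_ge0 ltW.
  move=> k /andP[_]; rewrite mem_index_iota => /andP[+ _].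
  by rewrite leqNgt => /negbTE kM; rewrite /U mM kM diam_pow_set0.
apply: (@le_trans _ _ (\sum_(0 <= M <oo) (if (m <= M)%N then q ^+ M else 0)%:E)%E).
  by apply: lee_nneseries => // M _ _; apply: nneseries_ge0 => *; exact: diam_pow_ge0.
apply: nneseries_le_bound => [M|l].
  by case: ifP => _; rewrite lee_fin// exprn_ge0// ltW.
apply: (@le_trans _ _ (q ^+ m / (1 - q))%:E); last first.
  by rewrite lee_fin N'P// leq_maxr.
rewrite sumEFin lee_fin ler_pdivlMr ?subr_gt0//.
have -> : (\sum_(0 <= i < l) (if (m <= i)%N then q ^+ i else 0)) * (1 - q) =
          if (m <= l)%N then q ^+ m - q ^+ l else 0.
  elim: l => [|l IHl].
    by rewrite big_geq// mul0r leqn0; case: eqP => // ->; rewrite subrr.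
  rewrite big_nat_recr//= mulrDl IHl.
  case: (ltngtP m l) => ml.
  - by rewrite (leqW (ltnW ml)) exprS; ring.
  - by rewrite [(m <= l.+1)%N]leq_eqVlt ltnS leqNgt ml orbF; case: eqP => [->|_]; ring.
  - by rewrite ml leqnSn exprS; ring.
case: ifP => _; last by rewrite exprn_ge0 ?ltW.
by rewrite lerBlDr lerDl exprn_ge0 ?ltW.
Qed.

End AdicCells.

(** * The set Z_b has dimension zero *)

Lemma powR_gt1 (R : realType) (a t : R) : 1 < a -> 0 < t -> 1 < a `^ t.
Proof.
move=> a1 t0; have a0 : 0 < a by apply: lt_trans a1.
have : 1 `^ t < a `^ t by apply: gt0_ltr_powR; rewrite ?nnegrE// ltW.
by rewrite powR1.
Qed.

Section ZsetDimension.
Variables (R : realType) (b : nat).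
Hypothesis b_ge2 : (2 <= b)%N.

Let b_gt0 : 0 < b%:R :> R. Proof. by rewrite ltr0n; lia. Qed.
Let bX_gt0 n : 0 < b%:R ^+ n :> R. Proof. by rewrite exprn_gt0. Qed.

Fixpoint nonzero_digits (M k : nat) : nat :=
  if M is M'.+1 then (nonzero_digits M' (k %/ b) + (k %% b != 0)%N)%N else 0%N.

Lemma nonzero_digits_truncn (x : R) M :
  nonzero_digits M (Num.truncn (b%:R ^+ M * `|x|)) =
  (\sum_(j < M) (digit b x j != 0%N))%N.
Proof.
elim: M => [|M IHM] /=; first by rewrite big_ord0.
by rewrite big_ord_recr /= -IHM truncn_div_expr// digitE.
Qed.

Lemma sum_ord_mul (V : nmodType) (F : nat -> V) n d :
  \sum_(k < n * d) F k = \sum_(i < n) \sum_(r < d) F (i * d + r)%N.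
Proof.
elim: n => [|n IHn]; first by rewrite mul0n !big_ord0.
rewrite big_ord_recr /= -IHn mulSn addnC -(big_mkord xpredT F).
rewrite (big_cat_nat (leq0n (n * d)) (leq_addr _ _))/= big_mkord.
congr (_ + _); rewrite -{1}[(n * d)%N]add0n big_addn addKn big_mkord.
by apply: eq_bigr => i _; rewrite addnC.
Qed.

(** Each of the M digits of k contributes independently a factor 1 if it is zero
    and z for the b - 1 other values; the digits of K lie above level M and are
    not counted. *)
Lemma sum_nonzero_digits (z : R) K M :
  \sum_(k < b ^ M) z ^+ nonzero_digits M (K * b ^ M + k) =
  (1 + (b%:R - 1) * z) ^+ M.
Proof.
elim: M => [|M IHM]; first by rewrite expn0 big_ord1 !expr0.
rewrite expnSr.
rewrite (sum_ord_mul (fun k => z ^+ nonzero_digits M.+1 (K * (b ^ M * b) + k))).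
have b0 : (0 < b)%N by lia.
have E i (r : 'I_b) : z ^+ nonzero_digits M.+1 (K * (b ^ M * b) + (i * b + r)) =
   z ^+ nonzero_digits M (K * b ^ M + i) * z ^+ (r != 0 :> nat).
  have -> : (K * (b ^ M * b) + (i * b + r) = (K * b ^ M + i) * b + r)%N by ring.
  by rewrite /= divnMDl// divn_small// addn0 modnMDl modn_small// exprD.
under eq_bigr do under eq_bigr do rewrite E.
under eq_bigr do rewrite -mulr_sumr.
rewrite -mulr_suml IHM exprSr; congr (_ * _).
case: (b) b0 => // c _; rewrite big_ord_recl /= expr0; congr (_ + _).
rewrite (eq_bigr (fun=> z)) => [|i _]; last by rewrite expr1.
by rewrite sumr_const card_ord -natr1 addrK mulr_natl.
Qed.

(** A frequency of zeros above 1 - 1/(p+1), attained for arbitrarily large M,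
    leaves fewer than M/(p+1) nonzero digits. *)
Lemma Zset_sparse_digits (x : R) p m : Zset R b x -> exists2 M, (m <= M)%N &
  (p * nonzero_digits M (Num.truncn (b%:R ^+ M * `|x|)) <= M)%N.
Proof.
rewrite /Zset /= limn_esup_lim => x1.
have e1 : (1%:E <= esups (fun M => (digit_freq b 0 M x)%:E) m.+1)%E.
  rewrite -x1; apply: lime_le; first exact: is_cvg_esups.
  by exists m.+1 => // n /= mn; exact: nonincreasing_esups.
have p0 : 0 < p.+1%:R :> R by rewrite ltr0n.
have : ((1 - p.+1%:R^-1)%:E < esups (fun M => (digit_freq b 0 M x)%:E) m.+1)%E.
  by apply: lt_le_trans e1; rewrite lte_fin ltrBlDr ltrDl invr_gt0.
move=> /ereal_sup_gt[_ [M /= mM <-]]; rewrite lte_fin digit_freqE => h.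
exists M; first exact: ltnW.
rewrite nonzero_digits_truncn.
have M0 : 0 < M%:R :> R by rewrite ltr0n; lia.
have S : (\sum_(j < M) (digit b x j == 0%N) + \sum_(j < M) (digit b x j != 0%N) = M)%N.
  rewrite -big_split /= (eq_bigr (fun=> 1%N)) ?sum1_card ?card_ord// => j _.
  by case: eqP.
move: S h; set Z := (\sum_(j < M) (digit b x j == 0%N))%N.
set W := (\sum_(j < M) (digit b x j != 0%N))%N => S.
rewrite ltr_pdivlMr// => h.
have : W%:R * p.+1%:R < M%:R :> R.
  have WE : W%:R = M%:R - Z%:R :> R by rewrite -S natrD addrC addKr.
  have : (1 - p.+1%:R^-1) * M%:R * p.+1%:R < Z%:R * p.+1%:R :> R.
    by rewrite ltr_pM2r.
  have -> : (1 - p.+1%:R^-1) * M%:R * p.+1%:R = M%:R * p.+1%:R - M%:R :> R.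
    by field; rewrite lt0r_neq0.
  by rewrite WE mulrBl => ?; lra.
by rewrite -natrM ltr_nat => ?; nia.
Qed.

(** With y = b^(-s/2), a prefix of length M with at most M/p nonzero digits
    satisfies 1 <= y^(p * nonzero digits) / y^M. Summing this weight over all
    prefixes bounds the number of such prefixes times b^(-sM) by
    ((1 + (b - 1) y^p) y)^M, whose base is below 1 once p is large. *)
Lemma Zset_null (s : R) : 0 < s -> hausdorff_measure s (Zset R b) = 0%E.
Proof.
move=> s0; pose y : R := b%:R `^ (- (s / 2)).
have y0 : 0 < y by rewrite powR_gt0.
have y1 : y < 1.
  rewrite /y powRN invf_lt1 ?powR_gt0//.
  by apply: powR_gt1; rewrite ?divr_gt0 ?ltr1n.
have yy : b%:R `^ (- s) = y * y.
  rewrite /y -powRD; last by rewrite (gt_eqF b_gt0) implybT.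
  by congr (_ `^ _); lra.
have [p pP] : exists p, (1 + (b%:R - 1) * y ^+ p) * y < 1.
  have : (fun p => (1 + (b%:R - 1) * y ^+ p) * y) @ \oo --> (1 + (b%:R - 1) * 0) * y.
    apply: cvgM; last exact: cvg_cst.
    apply: cvgD; first exact: cvg_cst.
    apply: cvgM; first exact: cvg_cst.
    by apply: cvg_expr; rewrite ger0_norm// ltW.
  rewrite mulr0 addr0 mul1r => /cvgrPdist_lt /(_ (1 - y)).
  rewrite subr_gt0 => /(_ y1) [p _ /(_ p (leqnn p)) /=].
  by rewrite ltr_norml => /andP[? ?]; exists p; lra.
have b1 : 0 <= b%:R - 1 :> R by rewrite subr_ge0 ler1n; lia.
have B0 : 0 < 1 + (b%:R - 1) * y ^+ p.
  by rewrite ltr_pwDl// mulr_ge0// exprn_ge0// ltW.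
apply: (@hausdorff_null_cells R b b_ge2 s ((1 + (b%:R - 1) * y ^+ p) * y)
  (fun M k => p * nonzero_digits M k <= M)%N); first exact: ltW.
- by rewrite pP mulr_gt0.
- move=> K M; rewrite yy exprMn exprMn mulrA ler_pM2r ?exprn_gt0//.
  rewrite -(sum_nonzero_digits _ K) natr_sum mulr_suml; apply: ler_sum => k _.
  rewrite -exprM; case: leqP => [h|_]; last by rewrite mul0r exprn_ge0// ltW.
  by rewrite mul1r ler_wiXn2l// ltW.
- by move=> x m Zx; exact: Zset_sparse_digits.
Qed.

Lemma hausdorff_dim_Zset : hausdorff_dim (Zset R b) = 0%E.
Proof.
apply/eqP; rewrite eq_le; apply/andP; split.
  apply/lee_addgt0Pr => e e0; rewrite add0e; apply: ereal_inf_lbound.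
  by exists e => //=; split; [exact: ltW|exact: Zset_null].
by apply: le_ereal_inf_tmp => _ [s [s0 null] <-]; rewrite lee_fin.
Qed.

End ZsetDimension.

(** * The complement of the normal numbers has dimension one *)

Section NonnormalDimension.
Variable R : realType.

(** Selecting all dyadic cells of level M in a unit interval gives the weight
    2^M 2^(-sM). *)
Lemma hausdorff_null_gt1 (s : R) (A : set R) : 1 < s ->
  hausdorff_measure s A = 0%E.
Proof.
move=> s1; have two0 : 0 < 2%:R :> R by rewrite ltr0n.
apply: (@hausdorff_null_cells R 2 isT s (2%:R `^ (1 - s)) (fun _ _ => true)).
- by rewrite ltW// (lt_trans _ s1).
- have -> : 1 - s = - (s - 1) by ring.
  by rewrite powRN invr_gt0 powR_gt0//= invf_lt1 ?powR_gt0// powR_gt1 ?ltr1n ?subr_gt0.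
- move=> K M; rewrite sum1_card card_ord powRD; last first.
    by rewrite (gt_eqF two0) implybT.
  by rewrite powRr1// exprMn natrX.
- by move=> x m _; exists m.
Qed.

Section MissingDigit.
Variable c : nat.
Hypothesis c_ge2 : (2 <= c)%N.
Let b := c.+1.

Let b_ge2 : (2 <= b)%N. Proof. by rewrite ltnW. Qed.
Let c_gt0 : 0 < c%:R :> R. Proof. by rewrite ltr0n ltnW. Qed.
Let b_gt0 : 0 < b%:R :> R. Proof. by rewrite ltr0n. Qed.
Let bX_gt0 n : 0 < b%:R ^+ n :> R. Proof. by rewrite exprn_gt0. Qed.
Let cX_gt0 n : 0 < c%:R ^+ n :> R. Proof. by rewrite exprn_gt0. Qed.

(** Without the digit c = b - 1 the enclosure improves: x stays away from the
    right end of its intervals. *)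
Lemma missing_digit_upper (x : R) a n : (forall i, (a i < c)%N) ->
  digit_enclosure b a x ->
  b%:R ^+ n.+1 * x <= (b * digits_value b a n + c)%N%:R.
Proof.
move=> ac ax; have /andP[_ h] := ax n.+1; apply: le_trans h _.
by rewrite ler_nat /= -addnS leq_add2l.
Qed.

Lemma missing_digit_not_normal (x : R) a : 0 <= x -> (forall i, (a i < c)%N) ->
  digit_enclosure b a x ->
  ~ normal_numbers R x.
Proof.
move=> x0 ac ax; apply: (@rare_digit_not_normal R x b c 0) => // i _.
rewrite digitE// ger0_norm//.
have -> : Num.truncn (b%:R ^+ i.+1 * x) = digits_value b a i.+1.
  apply: truncn_def; have /andP[-> _] := ax i.+1; rewrite /=.
  rewrite -(ltr_pM2l b_gt0) mulrA -exprS -natrM.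
  apply: le_lt_trans (missing_digit_upper i.+1 ac ax) _.
  by rewrite ltr_nat mulnS addnC ltn_add2r.
rewrite [X in (X %% _)%N]/= mulnC modnMDl modn_small; last exact: leqW (ac i).
by rewrite neq_ltn ac.
Qed.

(** Since the digit c is missing, two points whose prefixes of length n differ
    are at least b^-(n+1) apart. *)
Lemma missing_digit_gap (x y : R) a a' n :
  (forall i, (a i < c)%N) -> (forall i, (a' i < c)%N) ->
  digit_enclosure b a x ->
  digit_enclosure b a' y ->
  b%:R ^+ n.+1 * `|x - y| < 1 -> digits_value b a n = digits_value b a' n.
Proof.
wlog: x y a a' / (digits_value b a n <= digits_value b a' n)%N => [W|].
  move=> ac a'c ax a'y; have [|/ltnW] := leqP (digits_value b a n) (digits_value b a' n).
    by move=> le xy; exact: (W x y).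
  by move=> le; rewrite distrC => xy; apply/esym; exact: (W y x).
move=> le ac a'c ax a'y xy; apply/eqP; rewrite eqn_leq le /= leqNgt; apply/negP => lt.
have h1 := missing_digit_upper n ac ax.
have /andP[h2 _] := a'y n.+1.
have h3 : (b * digits_value b a n + c)%N%:R + 1 <= b%:R ^+ n.+1 * y.
  apply: le_trans h2; rewrite natr1 ler_nat.
  apply: (@leq_trans (b * (digits_value b a n).+1)).
    by rewrite mulnS -addnS [X in (_ <= X)%N]addnC.
  by rewrite /= (leq_trans _ (leq_addr _ _))// leq_pmul2l.
move: xy; rewrite -{1}(gtr0_norm (bX_gt0 n.+1)) -normrM mulrBr ltr_norml.
move: (b%:R ^+ n.+1 * x) (b%:R ^+ n.+1 * y) h1 h3 => p q h1 h3 /andP[? ?].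
lra.
Qed.

Lemma digits_value_change_base a a' n :
  (forall i, (a i < c)%N) -> (forall i, (a' i < c)%N) ->
  digits_value b a n = digits_value b a' n ->
  digits_value c a n = digits_value c a' n.
Proof.
move=> ac a'c; elim: n => [//|n IHn] /= E.
have [E1 E2] : digits_value b a n = digits_value b a' n /\ a n = a' n.
  have lt k d : (forall i, (d i < c)%N) -> (d k < b)%N by move=> h; exact: leqW.
  have /(congr1 (divn^~ b)) Ed := E; have /(congr1 (modn^~ b)) Em := E.
  rewrite !(mulnC b) !divnMDl// !divn_small ?lt// !addn0 in Ed.
  by rewrite !(mulnC b) !modnMDl !modn_small ?lt// in Em.
by rewrite E2 IHn.
Qed.

(** The map g reads the base-c digits of u in base b = c + 1. If n is minimal
    with |g u - g v| >= b^-(n+1), then the first n - 1 digits of u and v agree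
    by [missing_digit_gap], so |u - v| <= c^-(n-1) (trivially if n = 0), while
    b^s <= c turns the lower bound on |g u - g v| into
    |g u - g v|^s >= c^-(n+1). *)
Lemma missing_digit_embedding (s : R) : 0 <= s -> b%:R `^ s <= c%:R ->
  exists g : R -> R,
    (forall u, 0 <= u < 1 -> ~ normal_numbers R (g u)) /\
    (forall u v, 0 <= u < 1 -> 0 <= v < 1 ->
       `|u - v| <= c%:R ^+ 2 * `|g u - g v| `^ s).
Proof.
move=> s0 bs.
have ac (u : R) i : (floor_digit c u i < c)%N by apply: floor_digit_lt.
have ab (u : R) i : (floor_digit c u i < b)%N by rewrite leqW.
have /choice[g gP] u := @digits_realized R b b_ge2 (floor_digit c u) (ab u).
exists g; split=> [u u01|u v u01 v01].
  apply: (missing_digit_not_normal _ (ac u) (gP u)).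
  by have /andP[+ _] := gP u 0%N; rewrite expr0 mul1r; exact: le_trans.
have close n : b%:R ^+ n.+1 * `|g u - g v| < 1 -> `|u - v| <= c%:R ^- n.
  move=> /(missing_digit_gap (ac u) (ac v) (gP u) (gP v)).
  move=> /(digits_value_change_base (ac u) (ac v)).
  rewrite !digits_value_floor// => E.
  have tr (z : R) : 0 <= z < 1 -> (Num.truncn (c%:R ^+ n * z))%:R <= c%:R ^+ n * z
      < (Num.truncn (c%:R ^+ n * z)).+1%:R.
    by move=> /andP[z0 _]; apply: truncn_itv; rewrite mulr_ge0// ltW.
  have := tr u u01; have := tr v v01; rewrite E -natr1 => /andP[h1 h2] /andP[h3 h4].
  rewrite -[leRHS]mulr1 ler_pdivlMl// -{1}(gtr0_norm (cX_gt0 n)) -normrM mulrBr.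
  move: (c%:R ^+ n * u) (c%:R ^+ n * v) h1 h2 h3 h4 => p q h1 h2 h3 h4.
  by rewrite ler_norml; apply/andP; split; lra.
move: close; set D := `|g u - g v| => close.
have [D0|D0] := eqVneq D 0.
  have uv0 : `|u - v| <= 0.
    apply/ler_addgt0Pr => e e0; rewrite add0r.
    have [N NP] := expr_inv_small c_ge2 e0.
    apply: le_trans (close N _) _; first by rewrite D0 mulr0.
    exact: ltW (NP N (leqnn N)).
  by apply: le_trans uv0 _; rewrite mulr_ge0 ?powR_ge0// ltW.
have Dgt0 : 0 < D by rewrite lt0r D0 normr_ge0.
have exn : exists n, 1 <= b%:R ^+ n.+1 * D.
  have [N NP] := expr_inv_small b_ge2 Dgt0; exists N.
  by rewrite -ler_pdivrMl// mulr1 ltW// NP.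
case: (ex_minnP exn) => n n1 nmin.
have Ds : c%:R ^- n.+1 <= D `^ s.
  have : (b%:R ^+ n.+1)^-1 `^ s <= D `^ s.
    apply: ge0_ler_powR => //.
    - by rewrite nnegrE invr_ge0 ltW.
    - by rewrite nnegrE ltW.
    - by rewrite -[leLHS]mulr1 ler_pdivrMl.
  apply: le_trans; rewrite powR_inv_exprn// powRN exprVn.
  rewrite lef_pV2 ?posrE ?exprn_gt0 ?powR_gt0//.
  by apply: lerXn2r; rewrite ?nnegrE ?powR_ge0// ltW.
have uvn : `|u - v| <= c%:R ^+ 2 * c%:R ^- n.+1.
  case: n nmin {n1 Ds} => [|n] nmin.
    apply: (@le_trans _ _ 1).
      case/andP: u01 => ? ?; case/andP: v01 => ? ?.
      by rewrite ler_norml; apply/andP; split; lra.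
    rewrite expr1 expr2 mulfK ?gt_eqF// ler1n; exact: ltnW.
  have -> : c%:R ^+ 2 * c%:R ^- n.+2 = c%:R ^- n :> R.
    by rewrite -[n.+2]addn2 exprD invfM mulrCA mulfV ?mulr1// expf_neq0// gt_eqF.
  apply: close; rewrite ltNge; apply/negP => /nmin; by rewrite ltnn.
by apply: le_trans uvn _; rewrite ler_pM2l.
Qed.

End MissingDigit.

(** A cover of the image of [missing_digit_embedding] pulls back to a cover of
    [0, 1) by intervals of length at most a constant times diam^s, so its
    s-weight is bounded below by the Lebesgue measure of [0, 1). *)
Lemma nonnormal_not_null (s : R) : 0 <= s < 1 ->
  hausdorff_measure s (~` normal_numbers R) <> 0%E.
Proof.
move=> /andP[s0 s1] null.
(* (c+1)^s = (c+1) / (c+1)^(1-s) <= (c+1) / 2 <= c once (c+1)^(1-s) >= 2. *)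
have [c [c2 bs]] : exists c, (2 <= c)%N /\ c.+1%:R `^ s <= c%:R :> R.
  have s1' : 0 < 1 - s by rewrite subr_gt0.
  pose t : R := 2%:R `^ (1 - s)^-1; pose c := maxn 2 (Num.truncn t).
  exists c; split; first exact: leq_maxl.
  have ct : t <= c.+1%:R.
    by apply: ltW; apply: lt_le_trans (truncnS_gt t) _; rewrite ler_nat ltnS leq_maxr.
  have two : 2%:R <= c.+1%:R `^ (1 - s).
    have -> : 2%:R = t `^ (1 - s) by rewrite -powRrM mulVf ?gt_eqF// powRr1.
    by apply: ge0_ler_powR; rewrite ?nnegrE ?powR_ge0//; exact: ltW.
  have : c.+1%:R = c.+1%:R `^ s * c.+1%:R `^ (1 - s) :> R.
    rewrite -powRD; last by rewrite implybE pnatr_eq0 orbT.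
    by rewrite addrC subrK powRr1.
  have c1 : c.+1%:R <= 2 * c%:R :> R by rewrite -natrM ler_nat /c; lia.
  have p0 : 0 < c.+1%:R `^ s :> R by rewrite powR_gt0.
  move: (c.+1%:R `^ s) (c.+1%:R `^ (1 - s)) two p0 => X Y Y2 X0 E.
  have : X * 2 <= X * Y by rewrite ler_pM2l.
  by move: c1; rewrite E => *; lra.
have [g [gnn gH]] := missing_digit_embedding c2 s0 bs.
pose C : R := c%:R ^+ 2.
have C0 : 0 < C by rewrite exprn_gt0// ltr0n; lia.
have e0 : 0 < (4 * C)^-1 by rewrite invr_gt0 mulr_gt0.
have [U [AU dU Ue]] := (hausdorff_nullP s _).1 null 1 _ ltr01 e0.
have /choice[W WP] i : exists W : set R, [/\ measurable W,
    forall u, 0 <= u < 1 -> U i (g u) -> W u &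
    (lebesgue_measure W <= (2 * C)%:E * diam_pow s (U i))%E].
  have [[v v01 Uv]|noU] := pselect (exists2 v, 0 <= v < 1 & U i (g v)); last first.
    exists set0; split=> //.
    - by move=> u u01 Uu; apply: noU; exists u.
    - by rewrite measure0 mule_ge0 ?diam_pow_ge0// lee_fin mulr_ge0// ltW.
  have [d d0 dE] : exists2 d, 0 <= d & diam (U i) = d%:E.
    have := diam_ge0 (U i); have := dU i.
    by case: (diam (U i)) => [d _ d0| |] //; exists d.
  pose r := C * d `^ s.
  have r0 : 0 <= r by rewrite mulr_ge0 ?powR_ge0// ltW.
  exists `[v - r, v + r]%classic; split => //.
    move=> u u01 Uu; rewrite /= in_itv /=.
    have : `|u - v| <= r.
      apply: le_trans (gH u v u01 v01) _; rewrite ler_pM2l//.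
      apply: ge0_ler_powR; rewrite ?nnegrE//.
      by have := dist_le_diam Uu Uv; rewrite dE lee_fin.
    by rewrite ler_norml => /andP[? ?]; apply/andP; split; lra.
  rewrite /diam_pow; case: eqP => [U0|_]; first by move: Uv; rewrite U0.
  rewrite dE poweR_EFin lebesgue_measure_itv /= lte_fin.
  case: ifP => _; last by rewrite -EFinM lee_fin mulr_ge0 ?powR_ge0// mulr_ge0// ltW.
  by rewrite -EFinD -EFinM lee_fin /r; lra.
have : (lebesgue_measure (`[0%R, 1%R[%classic : set R) <=
        \sum_(0 <= i <oo) lebesgue_measure (W i))%E.
  apply: measure_sigma_subadditive => //.
    by move=> i; have [] := WP i.
  move=> u; rewrite /= in_itv /= => u01.
  have [i _ Ui] := AU _ (gnn u u01).
  by exists i => //; have [_ + _] := WP i; exact.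
apply/negP; rewrite -ltNge.
apply: (@le_lt_trans _ _ (\sum_(0 <= i <oo) (2 * C)%:E * diam_pow s (U i))%E).
  by apply: lee_nneseries => // i _; have [_ _] := WP i.
rewrite nneseriesZl//; last by move=> i _; exact: diam_pow_ge0.
apply: (@le_lt_trans _ _ ((2 * C)%:E * ((4 * C)^-1)%:E)%E).
  by apply: lee_wpmul2l => //; rewrite lee_fin mulr_ge0// ltW.
rewrite lebesgue_measure_itv /= lte_fin ltr01 -EFinM oppr0 adde0 lte_fin.
have -> : 2 * C * (4 * C)^-1 = 2^-1 by field; rewrite gt_eqF.
by rewrite invf_lt1// ltr1n.
Qed.

Lemma hausdorff_dim_nonnormal : hausdorff_dim (~` normal_numbers R) = 1%E.
Proof.
apply/eqP; rewrite eq_le; apply/andP; split.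
  apply/lee_addgt0Pr => e e0; apply: ereal_inf_lbound; exists (1 + e) => //=.
  by split; [rewrite addr_ge0// ltW|apply: hausdorff_null_gt1; rewrite ltrDl].
apply: le_ereal_inf_tmp => _ [s [s0 null] <-]; rewrite lee_fin leNgt.
by apply/negP => s1; apply: (@nonnormal_not_null s) null; rewrite s0.
Qed.

End NonnormalDimension.

Theorem corollary1p4 (R : realType) :
  [/\ ~ super_dense (normal_numbers R),
      super_dense (~` normal_numbers R) /\
      (forall b : nat, (2 <= b)%N -> super_dense (Zset R b)) &
      (forall b : nat, (2 <= b)%N -> hausdorff_dim (Zset R b) = 0%E) /\
      hausdorff_dim (~` normal_numbers R) = 1%E].
Proof.
split; first exact: normal_not_super_dense.
  split; first exact: nonnormal_super_dense.
  by move=> b b2; exact: Zset_super_dense.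
split; last exact: hausdorff_dim_nonnormal.
by move=> b b2; exact: hausdorff_dim_Zset.
Qed.
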